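(* Let $X$ be a non-empty finite set, let $b : X \times X \to [0,\infty)$ be a symmetric map with $b(x,x)=0$ for all $x \in X$, and let $V : X \to \mathbb{R}$ be a map. Let $\mathcal{L}_{b,V}$ be the discrete Laplacian over $X$ with potential $V$, and let $\mathcal{L}_{b,V=0}$ be the discrete Laplacian with the same $b$ and with zero potential. Then the self-adjoint operators $\mathcal{L}_{b,V}$ and $\mathcal{L}_{b,V=0}$ are isospectral if and only if $V=0$.
   Context: The discrete Laplacian $\mathcal{L}_{b,V}$ is the self-adjoint operator on $\mathbb{C}^{|X|}$ (the space of functions $f : X \to \mathbb{C}$ with its standard inner product) acting as $$(\mathcal{L}_{b,V} f)(x) = \sum_{y \in X} b(x,y)\,(f(x)-f(y)) + V(x) f(x), \qquad x \in X.$$ Two self-adjoint operators on the same finite-dimensional space are called isospectral if and only if they have the same eigenvalues, counted with multiplicities. *)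

(* Defs.v *)
(* R : realType is an arbitrary model of the real numbers, and R[i] is the field of
   complex numbers over it. *)
From HB Require Import structures.
From mathcomp Require Import all_boot all_order all_algebra.
From mathcomp Require Import complex reals.

Set Implicit Arguments.
Unset Strict Implicit.
Unset Printing Implicit Defensive.

Import Order.TTheory GRing.Theory Num.Theory.
Local Open Scope ring_scope.
Local Open Scope complex_scope.

(* The scalars are R[i]^o because only the regular algebra carries the structure
   of a vector space over R[i] that the finite function space inherits. *)
Definition cfun (R : realType) (X : finType) : vectType R[i] :=
  {ffun X -> R[i]^o}.

Definition cfun_inner (R : realType) (X : finType) (f g : cfun R X) : R[i] :=
  \sum_(x : X) f x * Num.conj (g x).

Definition self_adjoint (R : realType) (X : finType) (A : 'End(cfun R X)) : Prop :=
  forall f g : cfun R X, cfun_inner (A f) g = cfun_inner f (A g).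

Definition laplacian_fun (R : realType) (X : finType)
    (b : X -> X -> R) (V : X -> R) (f : cfun R X) : cfun R X :=
  [ffun x => \sum_(y : X) (b x y)%:C * (f x - f y) + (V x)%:C * f x].

Definition laplacian (R : realType) (X : finType)
    (b : X -> X -> R) (V : X -> R) : 'End(cfun R X) :=
  linfun (laplacian_fun b V).

(* For self-adjoint operators, the multiplicity of an eigenvalue is the dimension
   of its eigenspace; this dimension is 0 when a is not an eigenvalue. *)
Definition isospectral (R : realType) (X : finType) (A B : 'End(cfun R X)) : Prop :=
  forall a : R[i], \dim (passmx.leigenspace A a) = \dim (passmx.leigenspace B a).

Section LaplacianTheory.
Variables (R : realType) (X : finType) (b : X -> X -> R) (V : X -> R).

Fact laplacian_fun_is_linear : linear (laplacian_fun b V).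
Proof.
move=> a f g; apply/ffunP => x; rewrite !ffunE /=.
rewrite scalerDr addrACA; congr (_ + _).
  rewrite scaler_sumr -big_split /=; apply: eq_bigr => y _.
  rewrite !ffunE opprD addrACA mulrDr; congr (_ + _).
  by rewrite -scalerBr scalerAr.
by rewrite mulrDr scalerAr.
Qed.

HB.instance Definition _ := GRing.isLinear.Build R[i] (cfun R X) (cfun R X) _
  (laplacian_fun b V) laplacian_fun_is_linear.

Lemma laplacianE (f : cfun R X) (x : X) :
  laplacian b V f x =
    \sum_(y : X) (b x y)%:C * (f x - f y) + (V x)%:C * f x.
Proof. by rewrite lfunE ffunE. Qed.

Lemma laplacian_self_adjoint :
  (forall x y, b x y = b y x) -> self_adjoint (laplacian b V).
Proof.
move=> bC f g; rewrite /cfun_inner.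
have conj_real (r : R) : Num.conj (r%:C : R[i]) = r%:C by exact: conjc_real.
under eq_bigr => x _ do rewrite laplacianE mulrDl mulr_suml.
under [RHS]eq_bigr => x _ do rewrite laplacianE rmorphD mulrDr rmorph_sum mulr_sumr.
rewrite !big_split /=; congr (_ + _); last first.
  by apply: eq_bigr => x _; rewrite rmorphM /= conj_real mulrCA mulrA.
under eq_bigr => x _ do under eq_bigr => y _ do rewrite mulrBr mulrBl.
under [RHS]eq_bigr => x _ do under eq_bigr => y _
  do rewrite rmorphM rmorphB /= conj_real mulrBr mulrBr.
under eq_bigr => x _ do rewrite sumrB.
under [RHS]eq_bigr => x _ do rewrite sumrB.
rewrite !sumrB; congr (_ - _).
  by apply: eq_bigr => x _; apply: eq_bigr => y _; rewrite mulrCA mulrA.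
rewrite exchange_big; apply: eq_bigr => x _; apply: eq_bigr => y _.
by rewrite bC mulrCA mulrA.
Qed.

End LaplacianTheory.

(* Main.v *)
From HB Require Import structures.
Require Import Defs.
From mathcomp Require Import all_boot all_order all_algebra.
From mathcomp Require Import complex reals.

(** Let L_V be the Laplacian with potential V, and write 1 for the constant
    function.  Isospectral self-adjoint operators share two invariants: the
    trace, and the sign of the spectrum.

    The trace of L_V exceeds that of L_0 by the sum of the values of V
    ([mxtrace_laplacian]), so isospectrality makes this sum vanish.  It is also
    the value at 1 of the quadratic form of L_V, because the differences in the
    Laplacian kill constants and L_V 1 = V ([laplacian1]).  Hence
    <L_V 1, 1> = 0.

    On the other hand L_0 is positive semidefinite: twice its form at f is the
    Dirichlet sum of b(x,y) |f x - f y|^2 ([laplacian0_form]).  Its eigenvalues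
    are therefore nonnegative, and so are those of L_V, which are the same.  A
    self-adjoint operator with nonnegative eigenvalues kills every vector at
    which its form vanishes ([self_adjoint_inner_eq0]).  At the vector 1 this
    gives V = L_V 1 = 0.

    Both invariants come from the unitary diagonalization of normal matrices.
    Isospectrality is a statement about dimensions of eigenspaces, so the
    operators are read as matrices in the basis of indicator functions, and a
    dimension is identified with the number of diagonal entries equal to the
    eigenvalue ([rank_eigenspace_normal]). *)

Set Implicit Arguments.
Unset Strict Implicit.
Unset Printing Implicit Defensive.

Import Order.TTheory GRing.Theory Num.Theory.
Local Open Scope ring_scope.
Local Open Scope sesquilinear_scope.

(** * Eigenspaces of normal matrices *)

(** If u diag(d) = a u, then each coordinate u_i with d_i <> a is zero. *)
Lemma eigenspace_diag_mx (F : fieldType) n (d : 'rV[F]_n) (a : F) :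
  (eigenspace (diag_mx d) a
     :=: \sum_(i | d 0 i == a) <<delta_mx 0 i : 'rV[F]_n>>)%MS.
Proof.
apply/eqmxP/andP; split; last first.
  apply/sumsmx_subP => i /eqP da; rewrite genmxE; apply/eigenspaceP.
  by rewrite -rowE row_diag_mx da.
apply/rV_subP => u /eigenspaceP; rewrite mul_mx_diag => /rowP ua.
rewrite (row_sum_delta u); apply: summx_sub => i _.
have [da|nda] := eqVneq (d 0 i) a.
  by rewrite scalemx_sub // (sumsmx_sup i) ?da // genmxE.
suff -> : u 0 i = 0 by rewrite scale0r sub0mx.
have /eqP := ua i; rewrite !mxE mulrC -subr_eq0 -mulrBl mulf_eq0 subr_eq0.
by rewrite (negPf nda) => /eqP.
Qed.

Lemma rank_eigenspace_diag_mx (F : fieldType) n (d : 'rV[F]_n) (a : F) :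
  \rank (eigenspace (diag_mx d) a) = #|[set i | d 0 i == a]|.
Proof.
have dx : mxdirect (\sum_(i | d 0 i == a) <<delta_mx 0 i : 'rV[F]_n>>).
  by apply: mxdirect_delta => i j _ _.
rewrite eigenspace_diag_mx (mxdirectP dx) /=.
under eq_bigr => i _ do rewrite genmxE mxrank_delta.
by rewrite sum1dep_card.
Qed.

Lemma rank_eigenspace_conj (F : fieldType) n (P D : 'M[F]_n) (a : F) :
  P \in unitmx ->
  \rank (eigenspace (invmx P *m D *m P) a) = \rank (eigenspace D a).
Proof.
move=> Pu; rewrite !mxrank_ker; congr (_ - _)%N.
have -> : invmx P *m D *m P - a%:M = invmx P *m (D - a%:M) *m P.
  by rewrite mulmxBr mulmxBl scalar_mxC -(mulmxA a%:M) mulVmx // mulmx1.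
rewrite mxrankMfree ?row_free_unit // -mxrank_tr trmx_mul.
by rewrite mxrankMfree ?mxrank_tr // row_free_unit unitmx_tr unitmx_inv.
Qed.

(** Equal fibre sizes make the two families permutations of each other. *)
Lemma sum_eq_fibers (V : zmodType) (I : finType) (d e : I -> V) :
  (forall a, #|[set i | d i == a]| = #|[set i | e i == a]|) ->
  \sum_i d i = \sum_i e i.
Proof.
move=> de; rewrite -(big_map d xpredT id) -(big_map e xpredT id).
apply: perm_big; rewrite /perm_eq; apply/allP => a _ /=; apply/eqP.
rewrite !count_map; have := de a; rewrite !cardsE !cardE.
by rewrite /enum_mem !size_filter.
Qed.

Section NormalMatrices.
Variable C : numClosedFieldType.

(** For a normal matrix the geometric multiplicity of a is its number of
    occurrences in any unitary diagonalization. *)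
Lemma rank_eigenspace_normal n (A : 'M[C]_n) (a : C) : A \is normalmx ->
  \rank (eigenspace A a) = #|[set i | spectral_diag A 0 i == a]|.
Proof.
move=> /orthomx_spectralP {1}->.
by rewrite rank_eigenspace_conj ?spectral_unit // rank_eigenspace_diag_mx.
Qed.

Lemma mxtrace_normal n (A : 'M[C]_n) : A \is normalmx ->
  \tr A = \sum_i spectral_diag A 0 i.
Proof.
move=> /orthomx_spectralP {1}->.
by rewrite mxtrace_mulC mulmxA mulmxV ?spectral_unit // mul1mx mxtrace_diag.
Qed.

(** The trace is the sum of the diagonal entries of a diagonalization, which
    the geometric multiplicities determine up to order.  Without
    diagonalizability this fails: multiplicities of eigenspaces do not
    determine the trace. *)
Lemma mxtrace_eq_rank_eigenspace n (A B : 'M[C]_n) :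
  A \is normalmx -> B \is normalmx ->
  (forall a, \rank (eigenspace A a) = \rank (eigenspace B a)) ->
  \tr A = \tr B.
Proof.
move=> An Bn AB; rewrite !mxtrace_normal //; apply: sum_eq_fibers => a.
by rewrite -!rank_eigenspace_normal.
Qed.

(** In coordinates w along an orthonormal eigenbasis, the form is the sum of
    the nonnegative terms d_i |w_i|^2.  If it vanishes, then each d_i w_i does,
    and these are the coordinates of u A. *)
Lemma normal_form_eq0 n (A : 'M[C]_n) (u : 'rV[C]_n) : A \is normalmx ->
  (forall a, eigenvalue A a -> 0 <= a) ->
  (u *m A *m u ^t*) 0 0 = 0 -> u *m A = 0.
Proof.
move=> An A_ge0; set P := spectralmx A; set d := spectral_diag A.
have defA : A = invmx P *m diag_mx d *m P by exact/orthomx_spectralP.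
have d_ge0 i : 0 <= d 0 i.
  apply: A_ge0; rewrite /eigenvalue -mxrank_eq0 rank_eigenspace_normal //.
  by rewrite cards_eq0; apply/set0Pn; exists i; rewrite inE.
(* Row vectors act on the left, and the rows of P form the eigenbasis; hence
   the coordinates of u in it are u P^-1. *)
set w := u *m invmx P.
have -> : u *m A = w *m diag_mx d *m P by rewrite {1}defA !mulmxA.
have wE : w ^t* = P *m u ^t*.
  rewrite /w trmx_mul map_mxM /= invmx_unitary ?spectral_unitarymx //.
  by rewrite trmxCK.
rewrite -(mulmxA _ P) -wE mul_mx_diag mxE => /eqP.
rewrite psumr_eq0 => [|i _]; last first.
  by rewrite !mxE mulrAC -normCK mulr_ge0 ?exprn_ge0.
move=> /allP w0; suff -> : (\matrix_(i, j) (w i j * d 0 j)) = 0 :> 'rV_n.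
  by rewrite mul0mx.
apply/rowP => i; have := w0 i (mem_index_enum _); rewrite !mxE /=.
by rewrite mulf_eq0 conjC_eq0 => /orP[/eqP //|/eqP ->]; rewrite mul0r.
Qed.

End NormalMatrices.

(** * Self-adjoint operators on functions over a finite set *)

Section Coordinates.
Variables (R : realType) (X : finType).
Local Notation n := #|X|.
Local Notation C := R[i].

Definition coords (f : cfun R X) : 'rV[C]_n := \row_i f (enum_val i).
Definition of_coords (u : 'rV[C]_n) : cfun R X := [ffun x => u 0 (enum_rank x)].

Lemma coordsK : cancel coords of_coords.
Proof. by move=> f; apply/ffunP => x; rewrite ffunE mxE enum_rankK. Qed.

Lemma of_coordsK : cancel of_coords coords.
Proof. by move=> u; apply/rowP => i; rewrite mxE ffunE enum_valK. Qed.

Fact coords_is_linear : linear coords.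
Proof. by move=> a f g; apply/rowP => i; rewrite !mxE !ffunE. Qed.

HB.instance Definition _ := GRing.isLinear.Build C (cfun R X) 'rV[C]_n _
  coords coords_is_linear.

Fact of_coords_is_linear : linear of_coords.
Proof. by move=> a u v; apply/ffunP => x; rewrite !ffunE !mxE. Qed.

HB.instance Definition _ := GRing.isLinear.Build C 'rV[C]_n (cfun R X) _
  of_coords of_coords_is_linear.

(** The matrix of A in the orthonormal basis of indicator functions, in the row
    convention: coordinates are multiplied by it on the right. *)
Definition opmx (A : 'End(cfun R X)) : 'M[C]_n :=
  lin1_mx (coords \o A \o of_coords).

Lemma coords_app (A : 'End(cfun R X)) f : coords (A f) = coords f *m opmx A.
Proof. by rewrite mul_rV_lin1 /= coordsK. Qed.

Lemma cfun_innerE (f g : cfun R X) :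
  cfun_inner f g = (coords f *m (coords g) ^t*) 0 0.
Proof.
rewrite /cfun_inner mxE (reindex (@enum_val X predT)) /=; last first.
  by exists enum_rank => x _; rewrite ?enum_valK ?enum_rankK.
by apply: eq_bigr => i _; rewrite !mxE.
Qed.

(** A row base of M, pulled back to functions, is a basis of the subspace that
    the row space of M describes. *)
Lemma dim_coords (U : {vspace cfun R X}) (M : 'M[C]_n) :
  (forall f, (f \in U) = (coords f <= M)%MS) -> \dim U = \rank M.
Proof.
move=> UM; pose e := [tuple of_coords (row i (row_base M)) | i < \rank M].
suff /size_basis : basis_of U e by [].
have sumE (k : 'I_(\rank M) -> C) : \sum_i k i *: e`_i =
    of_coords ((\row_i k i) *m row_base M).
  rewrite mulmx_sum_row linear_sum; apply: eq_bigr => i _.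
  by rewrite -tnth_nth tnth_mktuple mxE linearZ.
apply/andP; split.
  rewrite eqEsubv; apply/andP; split.
    apply/span_subvP => _ /mapP[i _ ->].
    by rewrite UM of_coordsK (submx_trans (row_sub _ _)) ?eq_row_base.
  apply/subvP => f; rewrite UM -(eq_row_base M) => /submxP[u fu].
  have -> : f = \sum_i u 0 i *: e`_i.
    rewrite sumE -[f]coordsK fu; congr (of_coords (_ *m _)).
    by apply/rowP => i; rewrite mxE.
  by apply: memv_suml => i _; rewrite memvZ // memv_span // mem_nth ?size_tuple.
apply/freeP => k; rewrite sumE => /(congr1 coords).
rewrite of_coordsK linear0 => /eqP.
rewrite mulmx_free_eq0 ?row_base_free // => /eqP/rowP k0 i.
by have := k0 i; rewrite !mxE.
Qed.

Lemma mem_leigenspace (A : 'End(cfun R X)) a f :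
  (f \in passmx.leigenspace A a) = (A f == a *: f).
Proof.
by rewrite memv_ker add_lfunE opp_lfunE scale_lfunE id_lfunE subr_eq0.
Qed.

Lemma dim_leigenspace (A : 'End(cfun R X)) a :
  \dim (passmx.leigenspace A a) = \rank (eigenspace (opmx A) a).
Proof.
apply: dim_coords => f; rewrite mem_leigenspace.
rewrite -(inj_eq (can_inj coordsK)) linearZ /= coords_app.
by apply/eqP/eigenspaceP.
Qed.

(** Self-adjointness, tested on pairs of indicator functions, says that the
    matrix is Hermitian. *)
Lemma opmx_normal (A : 'End(cfun R X)) : self_adjoint A -> opmx A \is normalmx.
Proof.
move=> Asa; apply/hermitian_normalmx/is_hermitianmxP.
rewrite expr0 scale1r; apply/matrixP => i j.
have := Asa (of_coords (delta_mx 0 i)) (of_coords (delta_mx 0 j)).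
rewrite !cfun_innerE !coords_app !of_coordsK.
rewrite trmx_mul map_mxM /= mulmxA.
rewrite -!rowE trmx_delta map_delta_mx -!colE.
by rewrite !mxE.
Qed.

Lemma mxtrace_isospectral (A B : 'End(cfun R X)) :
  self_adjoint A -> self_adjoint B -> isospectral A B ->
  \tr (opmx A) = \tr (opmx B).
Proof.
move=> Asa Bsa AB; apply: mxtrace_eq_rank_eigenspace; try exact: opmx_normal.
by move=> a; rewrite -!dim_leigenspace.
Qed.

(** The equality case of the variational principle: where the form of a
    positive semidefinite operator reaches its minimum 0, the operator
    vanishes. *)
Lemma self_adjoint_inner_eq0 (A : 'End(cfun R X)) (f : cfun R X) :
  self_adjoint A -> (forall a, passmx.leigenvalue A a -> 0 <= a) ->
  cfun_inner (A f) f = 0 -> A f = 0.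
Proof.
move=> Asa A_ge0; rewrite cfun_innerE coords_app => Aff.
apply: (can_inj coordsK); rewrite coords_app linear0.
apply: normal_form_eq0 Aff; first exact: opmx_normal.
move=> a; rewrite /eigenvalue -mxrank_eq0 -dim_leigenspace dimv_eq0.
exact: A_ge0.
Qed.

Lemma cfun_inner_gt0 (f : cfun R X) : f != 0 -> 0 < cfun_inner f f.
Proof.
move=> f0; have sq x : f x * Num.conj (f x) = `|f x : C| ^+ 2 by rewrite normCK.
have ge0 x : 0 <= f x * Num.conj (f x) by rewrite sq exprn_ge0.
rewrite lt0r sumr_ge0 ?andbT // psumr_eq0 //; apply: contra f0 => /allP h.
apply/eqP/ffunP => x; rewrite ffunE; have := h x (mem_index_enum _).
by rewrite sq expf_eq0 normr_eq0 => /eqP.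
Qed.

(** For an eigenvector f of eigenvalue a, <A f, f> = a <f, f>. *)
Lemma leigenvalue_ge0 (A : 'End(cfun R X)) a :
  (forall f, 0 <= cfun_inner (A f) f) -> passmx.leigenvalue A a -> 0 <= a.
Proof.
move=> A_ge0; rewrite /passmx.leigenvalue => nz.
have f0 := vpick0 (passmx.leigenspace A a).
have := memv_pick (passmx.leigenspace A a); rewrite mem_leigenspace => /eqP Af.
move: f0 Af; set f := vpick _ => f0 Af.
have /cfun_inner_gt0 ff : f != 0 by rewrite f0.
have := A_ge0 f; rewrite Af.
have -> : cfun_inner (a *: f) f = a * cfun_inner f f.
  by rewrite /cfun_inner mulr_sumr; apply: eq_bigr => x _; rewrite ffunE mulrA.
by rewrite pmulr_lge0.
Qed.

End Coordinates.

(** * The Laplacian *)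

Section Laplacian.
Variables (R : realType) (X : finType) (b : X -> X -> R).
Local Open Scope complex_scope.

(** The Laplacians differ by multiplication by V, whose matrix in the basis of
    indicator functions is diagonal with the values of V as entries. *)
Lemma mxtrace_laplacian (V : X -> R) :
  \tr (opmx (laplacian b V)) =
    \tr (opmx (laplacian b (fun=> 0))) + \sum_x (V x)%:C.
Proof.
rewrite /mxtrace [X in _ + X](reindex (@enum_val X predT)) /=; last first.
  by exists enum_rank => x _; rewrite ?enum_valK ?enum_rankK.
rewrite -big_split /=; apply: eq_bigr => i _.
rewrite !mxE /= !laplacianE mul0r addr0; congr (_ + _).
by rewrite !ffunE enum_valK mxE !eqxx mulr1.
Qed.

Lemma laplacian1 (V : X -> R) :
  laplacian b V [ffun=> 1] = [ffun x => (V x)%:C].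
Proof.
apply/ffunP => x; rewrite laplacianE !ffunE mulr1 big1 ?add0r // => y _.
by rewrite !ffunE subrr mulr0.
Qed.

Hypothesis b_ge0 : forall x y, 0 <= b x y.
Hypothesis b_sym : forall x y, b x y = b y x.

(** Exchanging x and y in one of the two copies of the form turns the
    factor conj (f x) into - conj (f y), by the symmetry of b; the sum of the
    copies then contains (f x - f y) times its conjugate. *)
Lemma laplacian0_form (f : cfun R X) :
  cfun_inner (laplacian b (fun=> 0) f) f *+ 2 =
    \sum_x \sum_y (b x y)%:C * `|f x - f y : R[i]| ^+ 2.
Proof.
have E : cfun_inner (laplacian b (fun=> 0) f) f =
    \sum_x \sum_y (b x y)%:C * (f x - f y) * Num.conj (f x).
  by apply: eq_bigr => x _; rewrite laplacianE mul0r addr0 mulr_suml.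
rewrite mulr2n {2}E exchange_big E -big_split /=; apply: eq_bigr => x _.
rewrite -big_split /=; apply: eq_bigr => y _.
rewrite (b_sym y x) normCK rmorphB /= -(opprB (f x) (f y)).
by rewrite mulrN mulNr -mulrBr -mulrA.
Qed.

Lemma laplacian0_ge0 (f : cfun R X) :
  0 <= cfun_inner (laplacian b (fun=> 0) f) f.
Proof.
rewrite -(pmulrn_lge0 _ (isT : (0 < 2)%N)) laplacian0_form.
apply: sumr_ge0 => x _; apply: sumr_ge0 => y _.
by rewrite mulr_ge0 ?exprn_ge0 // lecR.
Qed.

End Laplacian.

Theorem theorem8 (R : realType) (X : finType) (b : X -> X -> R) (V : X -> R)
    (X_nonempty : (0 < #|X|)%N)
    (b_ge0 : forall x y : X, 0 <= b x y)
    (b_sym : forall x y : X, b x y = b y x)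
    (b_diag : forall x : X, b x x = 0) :
  isospectral (laplacian b V) (laplacian b (fun _ : X => 0)) <->
  (forall x : X, V x = 0).
Proof.
split=> [iso x | V0]; last first.
  suff -> : laplacian b V = laplacian b (fun=> 0) by [].
  by apply/lfunP => f; apply/ffunP => x; rewrite !laplacianE V0.
have sa W : self_adjoint (laplacian b W) by exact: laplacian_self_adjoint.
have sumV : \sum_x (V x)%:C%C = 0 :> R[i].
  have := mxtrace_isospectral (sa V) (sa _) iso.
  by rewrite mxtrace_laplacian => /eqP; rewrite -subr_eq0 addrC addKr => /eqP.
have V_ge0 a : passmx.leigenvalue (laplacian b V) a -> 0 <= a.
  move=> aV; apply: (leigenvalue_ge0 (laplacian0_ge0 b_ge0 b_sym)).
  by move: aV; rewrite /passmx.leigenvalue -!dimv_eq0 iso.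
have : laplacian b V [ffun=> 1] = 0.
  apply: self_adjoint_inner_eq0 => //.
  rewrite laplacian1 /cfun_inner -[RHS]sumV; apply: eq_bigr => y _.
  by rewrite !ffunE rmorph1 mulr1.
by rewrite laplacian1 => /ffunP/(_ x); rewrite !ffunE => -[].
Qed.
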